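(* Let $\mathfrak g$ be the Lie superalgebra $\mathfrak{gl}(m|n)$, or $\mathfrak{sl}(m|n)$ with $m\neq n$, and let $V=\Bbbk^{m|n}$ be its tautological representation. Let $x\in\mathfrak g_{\bar 1}$ be an $\mathrm{ad}$-nilpotent element. Then $x$ is distinguished if and only if $V$ is indecomposable as a $\Bbbk[x]$-module; equivalently, $x$ is distinguished if and only if the checkered Young diagram $\mathbf D^x$ has exactly one row.
   Context: Base field $\Bbbk$: algebraically closed of characteristic $0$. $\mathfrak{gl}(m|n)=\mathrm{End}^\bullet(\Bbbk^{m|n})$ (all endomorphisms, with the supercommutator), $\mathfrak{sl}(m|n)$ is its sub-superalgebra of supertrace-zero endomorphisms. An odd element $x$ is $\mathrm{ad}$-nilpotent if $[x,x]$ is a nilpotent element of the reductive Lie algebra $\mathfrak g_{\bar 0}$, equivalently $x$ acts on $V$ by a nilpotent operator. ''$V$ as a $\Bbbk[x]$-module'' means $V$ as a ($\mathbb Z/2$-graded) module with the action of the odd operator $x$. The checkered Young diagram $\mathbf D^x$ of a nilpotent odd operator $x$ on $\Bbbk^{m|n}$ has one row for each Jordan block of $x$ (with respect to a homogeneous Jordan basis), the row length being the block size; the leftmost box corresponds to the vector annihilated by $x$; a box is black if the corresponding basis vector is even, white if it is odd. Diagrams are considered up to permutation of rows. An element $x\in\mathfrak g_{\bar 1}$ is distinguished if every semisimple element of the reductive Lie algebra $\mathfrak g_{\bar 0}$ (central elements of $\mathfrak g_{\bar 0}$ being counted as semisimple) commuting with $x$ lies in $Z(\mathfrak g)_{\bar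 0}$, where $Z(\mathfrak g)$ is the center of $\mathfrak g$. *)

(* Defs.v *)
(* World: Mathematical Components. *)
From HB Require Import structures.
From mathcomp Require Import all_boot all_order all_algebra.

Set Implicit Arguments.
Unset Strict Implicit.
Unset Printing Implicit Defensive.

Import GRing.Theory.
Local Open Scope ring_scope.

(* V = k^{m|n} is 'cV[k]_(m + n), with endomorphisms acting by A *m v: the    *)
(* first m coordinates are even, the last n odd. Parities are booleans, with  *)
(* false = even and true = odd.                                               *)

Section Parity.
Variables (k : fieldType) (m n : nat).

Definition vpart (p : bool) (v : 'cV[k]_(m + n)) : 'cV[k]_(m + n) :=
  if p then col_mx 0 (dsubmx v) else col_mx (usubmx v) 0.

Definition mpart (p : bool) (A : 'M[k]_(m + n)) : 'M[k]_(m + n) :=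
  if p then block_mx 0 (ursubmx A) (dlsubmx A) 0
  else block_mx (ulsubmx A) 0 0 (drsubmx A).

Definition strace (A : 'M[k]_(m + n)) : k^o :=
  \tr (ulsubmx A) - \tr (drsubmx A).

Fact vpart_is_linear p : linear (vpart p).
Proof.
by case: p => a u v; rewrite /vpart linearP scale_col_mx add_col_mx scaler0 addr0.
Qed.
HB.instance Definition _ p :=
  GRing.isLinear.Build k _ _ _ (vpart p) (vpart_is_linear p).

Fact mpart_is_linear p : linear (mpart p).
Proof.
by case: p => a A B; rewrite /mpart scale_block_mx add_block_mx !scaler0 !addr0;
  congr block_mx; apply/matrixP => i j; rewrite !mxE.
Qed.
HB.instance Definition _ p :=
  GRing.isLinear.Build k _ _ _ (mpart p) (mpart_is_linear p).

Fact strace_is_linear : linear strace.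
Proof.
move=> a A B.
have ul : ulsubmx (a *: A + B) = a *: ulsubmx A + ulsubmx B.
  by apply/matrixP => i j; rewrite !mxE.
have dr : drsubmx (a *: A + B) = a *: drsubmx A + drsubmx B.
  by apply/matrixP => i j; rewrite !mxE.
by rewrite /strace ul dr !linearP /= opprD addrACA scalerBr.
Qed.
HB.instance Definition _ :=
  GRing.isLinear.Build k _ _ _ strace strace_is_linear.

Definition Vgr (p : bool) : {vspace 'cV[k]_(m + n)} :=
  lker (linfun (vpart (~~ p))).

Definition Mgr (p : bool) : {vspace 'M[k]_(m + n)} :=
  lker (linfun (mpart (~~ p))).

(* [A, B] = AB - (-1)^(|A||B|) BA on homogeneous A and B, extended            *)
(* bilinearly.                                                                *)
Definition scomm (A B : 'M[k]_(m + n)) : 'M[k]_(m + n) :=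
  \sum_(p : bool) \sum_(q : bool)
    (mpart p A *m mpart q B - (-1) ^+ (p && q) *: (mpart q B *m mpart p A)).

End Parity.

Definition gl_super (k : fieldType) (m n : nat) : {vspace 'M[k]_(m + n)} :=
  fullv.

Definition sl_super (k : fieldType) (m n : nat) : {vspace 'M[k]_(m + n)} :=
  lker (linfun (@strace k m n)).

Section LieSuperalgebra.
Variables (k : fieldType) (m n : nat) (g : {vspace 'M[k]_(m + n)}).
Implicit Types (h x z : 'M[k]_(m + n)).

Definition homog_part (p : bool) : {vspace 'M[k]_(m + n)} := (g :&: Mgr k m n p)%VS.
Local Notation g0 := (homog_part false).

Definition in_center z : Prop :=
  z \in g /\ (forall a, a \in g -> scomm z a = 0).

Definition in_center_even z : Prop := in_center z /\ z \in Mgr k m n false.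

Definition derived_even : {vspace 'M[k]_(m + n)} :=
  <<[seq scomm a b | a <- vbasis g0, b <- vbasis g0]>>%VS.

(* For h in the reductive Lie algebra g0 = Z(g0) + [g0, g0]: h is semisimple  *)
(* iff ad h is diagonalizable on g0 (so central elements are semisimple), and *)
(* h is nilpotent iff ad h is nilpotent on g0 and h has no central component, *)
(* i.e. h lies in [g0, g0].                                                   *)
Definition semisimple_even h : Prop :=
  h \in g0 /\
  exists b : seq 'M[k]_(m + n),
    basis_of g0 b /\ (forall e, e \in b -> exists c : k, scomm h e = c *: e).

Definition nilpotent_even h : Prop :=
  h \in derived_even /\
  exists N : nat, forall a, a \in g0 -> iter N (scomm h) a = 0.

Definition ad_nilpotent x : Prop := nilpotent_even (scomm x x).

Definition distinguished x : Prop :=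
  forall h, semisimple_even h -> scomm h x = 0 -> in_center_even h.

End LieSuperalgebra.

Section OddOperator.
Variables (k : fieldType) (m n : nat) (x : 'M[k]_(m + n)).

Definition graded_submodule (U : {vspace 'cV[k]_(m + n)}) : Prop :=
  U = (U :&: Vgr k m n false + U :&: Vgr k m n true)%VS /\
  (forall v, v \in U -> x *m v \in U).

Definition indecomposable_module : Prop :=
  (fullv : {vspace 'cV[k]_(m + n)}) <> 0%VS /\
  forall U W : {vspace 'cV[k]_(m + n)},
    graded_submodule U -> graded_submodule W ->
    (U + W)%VS = fullv -> (U :&: W)%VS = 0%VS ->
    U = 0%VS \/ W = 0%VS.

(* c lists the vectors of one homogeneous Jordan block, starting from the one *)
(* annihilated by x: x c_0 = 0 and x c_(i+1) = c_i.                           *)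
Definition jordan_chain (c : seq 'cV[k]_(m + n)) : Prop :=
  [/\ c != [::],
      forall v, v \in c -> exists p, v \in Vgr k m n p
    & forall i, (i < size c)%N -> x *m c`_i = (0 :: c)`_i].

Definition homog_jordan_basis (cs : seq (seq 'cV[k]_(m + n))) : Prop :=
  (forall c, c \in cs -> jordan_chain c) /\ basis_of fullv (flatten cs).

(* A checkered diagram is the list of its rows, each row being the list of    *)
(* its boxes from left to right, with true for a black box and false for a    *)
(* white one. Diagrams are identified up to permutation of rows, so D^x is    *)
(* the class of all D satisfying this predicate.                              *)
Definition checkered_diagram (D : seq (seq bool)) : Prop :=
  exists2 cs, homog_jordan_basis cs &
    perm_eq D [seq [seq v \in Vgr k m n false | v <- c] | c <- cs].

End OddOperator.

(* Main.v *)
(* Let x be nilpotent, with ker x of dimension r, which is the number of rows   *)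
(* of any diagram of x. If r = 1, an even h commuting with x acts on the line   *)
(* ker x by a scalar a, and h - a is nilpotent because it commutes with x. When *)
(* ad h is moreover diagonalizable on g_0, it vanishes there, so that h - a is  *)
(* diagonal and nilpotent, hence zero. If r > 1, a homogeneous Jordan basis     *)
(* splits V into two graded k[x]-submodules; the projection onto one of them,   *)
(* corrected by a scalar to lie in g, is even, semisimple and commutes with x   *)
(* but is not central. So distinguished and indecomposable both mean r = 1.     *)
From HB Require Import structures.
Require Import Defs.
From mathcomp Require Import all_boot all_order all_algebra.

Set Implicit Arguments.
Unset Strict Implicit.
Unset Printing Implicit Defensive.

Import GRing.Theory.
Local Open Scope ring_scope.

(** * Homogeneous Jordan bases *)

Lemma span_subbasis (K : fieldType) (vT : vectType K) (X : seq vT) :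
  exists2 b, basis_of <<X>>%VS b & {subset b <= X}.
Proof.
elim: X => [|v X [b bX sbX]]; first by exists [::]; rewrite ?span_nil ?nil_basis.
have [vX|vX] := boolP (v \in <<X>>%VS).
  exists b => [|u /sbX uX]; last by rewrite inE uX orbT.
  by rewrite span_cons (addv_idPr _) // -memvE.
exists (v :: b) => [|u]; last first.
  by rewrite !inE => /orP[->//|/sbX ->]; rewrite orbT.
rewrite /basis_of free_cons (basis_free bX) (span_basis bX) vX.
by rewrite !span_cons (span_basis bX) eqxx.
Qed.

Lemma span_cons0 (K : fieldType) (vT : vectType K) (X : seq vT) :
  (<<0%R :: X>> = <<X>>)%VS.
Proof. by rewrite span_cons; apply/addv_idPr; rewrite -memvE mem0v. Qed.

Section Chains.
Variables (K : fieldType) (vT : vectType K) (f : 'End(vT)).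
Implicit Types (c : seq vT) (cs : seq (seq vT)).

Definition chain c := [seq f v | v <- c] == belast 0 c.

Lemma chainP c :
  reflect (forall i, (i < size c)%N -> f c`_i = (0 :: c)`_i) (chain c).
Proof.
apply: (iffP eqP) => [fc i ic|fc].
  by rewrite -(nth_map 0 0 f ic) fc lastI nth_rcons size_belast ic.
apply: (@eq_from_nth _ 0); rewrite ?size_map ?size_belast // => i ic.
by rewrite (nth_map 0) // fc // lastI nth_rcons size_belast ic.
Qed.

Lemma chain_rcons c u : chain c -> f u = last 0 c -> chain (rcons c u).
Proof. by move=> /eqP fc fu; rewrite /chain map_rcons belast_rcons fc fu -lastI. Qed.

Lemma map_chains cs : all chain cs ->
  [seq f v | v <- flatten cs] = flatten [seq belast 0 c | c <- cs].
Proof.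
elim: cs => //= c cs IH /andP[/eqP fc /IH fcs].
by rewrite map_cat fc fcs.
Qed.

Lemma span_chain_stable c : chain c -> (f @: <<c>> <= <<c>>)%VS.
Proof.
move=> /eqP fc; rewrite limg_span fc; apply/span_subvP => v /mem_belast.
by rewrite inE => /orP[/eqP->|/memv_span//]; rewrite mem0v.
Qed.

Lemma span_chains_stable cs : all chain cs ->
  (f @: <<flatten cs>> <= <<flatten cs>>)%VS.
Proof.
elim: cs => [|c cs IH] /=; first by rewrite span_nil limg0 subvv.
case/andP=> /span_chain_stable fc /IH fcs.
by rewrite span_cat limgD addvS.
Qed.

Lemma dim_ker_chains cs : all chain cs -> all (fun c => c != [::]) cs ->
  free (flatten cs) -> \dim (<<flatten cs>> :&: lker f) = size cs.
Proof.
move=> chcs necs frcs; apply/eqP.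
rewrite -(eqn_add2r (\dim (f @: <<flatten cs>>))) limg_ker_dim (eqP frcs).
rewrite limg_span map_chains //.
pose tl := flatten [seq behead (belast 0 c) | c <- cs].
have -> : (<<flatten [seq belast 0%R c | c <- cs]>> = <<tl>>)%VS.
  rewrite /tl; elim: cs necs {chcs frcs tl} => //= -[|v c] cs IH //= /IH.
  by rewrite -cat_cons !span_cat span_cons0 => ->.
have sub_tl : subseq tl (flatten cs).
  rewrite /tl; elim: cs {necs chcs frcs tl} => //= c cs; apply: cat_subseq.
  by case: c => [|v c]; last (rewrite [v :: c in X in subseq _ X]lastI; exact: subseq_rcons).
have fr_tl : free tl.
  by have /subseq_uniqP -> := sub_tl; [exact: filter_free | exact: free_uniq].
rewrite (eqP fr_tl) /tl; apply/eqP.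
elim: cs necs {chcs frcs tl sub_tl fr_tl} => //= -[|v c] cs IH //= /IH.
by rewrite !size_cat size_belast /= => ->; rewrite addSn addnCA.
Qed.

End Chains.

Section GradedJordanBasis.
Variables (K : fieldType) (vT : vectType K) (f : 'End(vT)).
Variable Vg : bool -> {vspace vT}.
Hypothesis Vg_direct : (Vg false :&: Vg true = 0)%VS.
Hypothesis f_odd : forall p v, v \in Vg p -> f v \in Vg (~~ p).
Implicit Types (U : {vspace vT}) (cs : seq (seq vT)).

Definition graded U := U = (U :&: Vg false + U :&: Vg true)%VS.
Definition homogeneous : pred vT := [pred v | (v \in Vg false) || (v \in Vg true)].

Lemma Vg_disjoint p : (Vg p :&: Vg (~~ p) = 0)%VS.
Proof. by case: p => //=; rewrite capvC. Qed.

Lemma gradedP U : reflect (forall v, v \in U -> exists u : bool -> vT,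
    v = u false + u true /\ forall p, u p \in (U :&: Vg p)%VS)
  (U == U :&: Vg false + U :&: Vg true)%VS.
Proof.
apply: (iffP eqP) => [gU v|gU].
  rewrite {1}gU => /memv_addP[u0 u0U [u1 u1U ->]].
  by exists (fun p => if p then u1 else u0); split=> // -[].
apply/vspaceP => v; apply/idP/idP => [/gU[u [-> uU]]|]; first exact: memv_add.
by apply/subvP; rewrite subv_add !capvSl.
Qed.

Lemma graded_span X : all homogeneous X -> graded <<X>>.
Proof.
move=> /allP homX; apply/eqP; rewrite eqEsubv subv_add !capvSl !andbT.
apply/span_subvP => v vX; have /orP[vp|vp] := homX v vX.
  by apply: (subvP (addvSl _ _)); rewrite memv_cap vp memv_span.
by apply: (subvP (addvSr _ _)); rewrite memv_cap vp memv_span.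
Qed.

Lemma graded_limg U : graded U -> graded (f @: U).
Proof.
move=> /eqP/gradedP gU; apply/eqP/gradedP => _ /memv_imgP[v /gU[u [-> uU]] ->].
exists (fun p => f (u (~~ p))); split=> [|p]; first by rewrite linearD addrC.
have := uU (~~ p); rewrite !memv_cap => /andP[uU' /f_odd].
by rewrite negbK memv_img.
Qed.

Lemma graded_ker U : graded U -> graded (U :&: lker f).
Proof.
move=> /eqP/gradedP gU; apply/eqP/gradedP => v.
rewrite memv_cap memv_ker => /andP[/gU[u [-> uU]]].
rewrite linearD addr_eq0 => /eqP fu.
have fuV p : f (u p) \in Vg (~~ p) by apply: f_odd; apply: (subvP (capvSr U _)).
have fu0 : f (u false) = 0.
  apply/eqP; rewrite -memv0 -Vg_direct memv_cap fuV andbT fu memvN.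
  exact: (fuV true).
have fu1 : f (u true) = 0 by apply: oppr_inj; rewrite oppr0; rewrite -[LHS]fu -[RHS]fu0.
exists u; split=> // p; have := uU p.
by rewrite !memv_cap memv_ker => /andP[-> ->]; case: p; rewrite ?fu0 ?fu1 eqxx.
Qed.

Lemma homogeneous_preimage U v : graded U -> homogeneous v -> v \in (f @: U)%VS ->
  exists u, [&& u \in U, homogeneous u & f u == v].
Proof.
move=> /eqP/gradedP gU hv /memv_imgP[w /gU[u [-> uU]] vE].
have [p vp] : exists p, v \in Vg p by case/orP: hv; [exists false | exists true].
have uU' q : u q \in U /\ u q \in Vg q by apply/andP; rewrite -memv_cap.
have uV q : f (u q) \in Vg (~~ q) by case: (uU' q) => _ /f_odd.
have {}vE : v = f (u p) + f (u (~~ p)).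
  by rewrite vE linearD; case: (p) => //=; rewrite addrC.
have fup : f (u p) = 0.
  apply/eqP; rewrite -memv0 -(Vg_disjoint p) memv_cap uV andbT.
  have -> : f (u p) = v - f (u (~~ p)) by rewrite vE addrK.
  by rewrite memvB //; have := uV (~~ p); rewrite negbK.
exists (u (~~ p)); rewrite vE fup add0r eqxx andbT /=.
by have [-> ] := uU' (~~ p); rewrite /homogeneous /=; case: (~~ p) => ->; rewrite ?orbT.
Qed.

Lemma dim_graded U : graded U ->
  \dim U = (\dim (U :&: Vg false) + \dim (U :&: Vg true))%N.
Proof.
move=> gU; rewrite {1}gU -[RHS]dimv_sum_cap.
suff -> : (U :&: Vg false :&: (U :&: Vg true) = 0)%VS by rewrite dimv0 addn0.
by apply/eqP; rewrite -subv0 -Vg_direct capvS ?capvSr.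
Qed.

Lemma graded_complement U W : graded U -> graded W -> (W <= U)%VS ->
  exists D, [/\ all homogeneous D, (W + <<D>>)%VS = U
              & (size D + \dim W)%N = \dim U].
Proof.
move=> gU gW sWU.
pose C p := (U :&: Vg p :\: (W :&: Vg p))%VS.
have sWp p : (U :&: Vg p :&: (W :&: Vg p) = W :&: Vg p)%VS.
  by apply/capv_idPr; rewrite capvS.
have CW p : (C p + W :&: Vg p)%VS = (U :&: Vg p)%VS.
  by rewrite -(sWp p) addv_diff_cap.
have dC p : (\dim (C p) + \dim (W :&: Vg p))%N = \dim (U :&: Vg p).
  by rewrite -(dimv_cap_compl (U :&: Vg p) (W :&: Vg p)) sWp addnC.
exists (vbasis (C false) ++ vbasis (C true)); split.
- rewrite all_cat; apply/andP; split; apply/allP => v /vbasis_mem.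
    by move/(subvP (diffvSl _ _)); rewrite memv_cap /homogeneous /= => /andP[_ ->].
  by move/(subvP (diffvSl _ _)); rewrite memv_cap /homogeneous /= => /andP[_ ->]; rewrite orbT.
- rewrite span_cat !(span_basis (vbasisP _)) addvC {1}gW Monoid.mulmACA.
  by rewrite /= !CW -gU.
- by rewrite size_cat !size_tuple (dim_graded gW) (dim_graded gU) addnACA !dC.
Qed.

(* Prolong each chain of a basis of f(U) by a preimage of its last vector, and *)
(* add a complement of ker f :&: f(U) in ker f :&: U as chains of length one.  *)
Lemma homogeneous_jordan_basis N U : graded U -> (f @: U <= U)%VS ->
  iter N (lfun_img f) U = 0%VS ->
  exists2 cs, basis_of U (flatten cs) &
    all (fun c => [&& c != [::], all homogeneous c & chain f c]) cs.
Proof.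
elim: N U => [|N IH] U gU fU.
  by move=> /= ->; exists [::]; rewrite ?nil_basis.
rewrite iterSr => /(IH _ (graded_limg gU) (limgS _ fU)) [cs bcs ccs].
have chcs : all (chain f) cs by apply: sub_all ccs => c /and3P[].
have necs : all (fun c => c != [::]) cs by apply: sub_all ccs => c /and3P[].
have ex v : exists u, (homogeneous v && (v \in (f @: U)%VS)) ==>
    [&& u \in U, homogeneous u & f u == v].
  have [/andP[hv vU]|] := boolP (_ && _); last by exists 0.
  by apply: homogeneous_preimage.
pose pre c := xchoose (ex (last 0 c)).
have mem_cs c v : c \in cs -> v \in c -> v \in (f @: U)%VS.
  by move=> ccs' vc; apply: (basis_mem bcs); apply/flattenP; exists c.
have preP c : c \in cs -> [&& pre c \in U, homogeneous (pre c) & f (pre c) == last 0 c].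
  move=> ccs'; have /and3P[nec /allP homc _] := allP ccs c ccs'.
  have lc : last 0 c \in c by case: (c) nec => //= v c' _; apply: mem_last.
  by apply: (implyP (xchooseP (ex (last 0 c)))); rewrite homc ?(mem_cs c).
pose cs1 := [seq rcons c (pre c) | c <- cs].
pose Kf := (U :&: lker f)%VS; pose Kf' := (f @: U :&: lker f)%VS.
have sKf : (Kf' <= Kf)%VS by rewrite capvS.
have [D [homD spD szD]] :=
  graded_complement (graded_ker gU) (graded_ker (graded_limg gU)) sKf.
have fcs1 : (f @: <<flatten cs1>> = f @: U)%VS.
  rewrite -(span_basis bcs) limg_span map_chains; last first.
    apply/allP => _ /mapP[c ccs' ->]; have /and3P[_ _ /eqP fc] := preP c ccs'.
    by rewrite chain_rcons // (allP chcs).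
  rewrite /cs1; elim: (cs) => //= c cs' IHcs.
  by rewrite belast_rcons !span_cat span_cons0 IHcs.
have sub_cs : (f @: U <= <<flatten cs1>>)%VS.
  rewrite -(span_basis bcs); apply: sub_span => v /flattenP[c ccs' vc].
  apply/flattenP; exists (rcons c (pre c)); first exact: map_f.
  by rewrite mem_rcons inE vc orbT.
have sz_cs1 : size (flatten cs1) = (size (flatten cs) + size cs)%N.
  rewrite /cs1; elim: (cs) => //= c cs' IHcs.
  by rewrite !size_cat size_rcons IHcs addSn !addnS addnA.
have frcs := basis_free bcs.
have dKf' : \dim Kf' = size cs.
  by rewrite /Kf' -(span_basis bcs) dim_ker_chains.
exists (cs1 ++ [seq [:: v] | v <- D]); last first.
  rewrite all_cat; apply/andP; split; apply/allP.
    move=> _ /mapP[c ccs' ->]; have /and3P[pU ph /eqP fp] := preP c ccs'.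
    have /and3P[_ homc chc] := allP ccs c ccs'.
    by rewrite all_rcons ph homc chain_rcons // andbT -size_eq0 size_rcons.
  move=> _ /mapP[v vD ->]; rewrite /= (allP homD) //=.
  have : v \in Kf by rewrite /Kf -spD (subvP (addvSr _ _)) // memv_span.
  by rewrite /chain /= memv_cap memv_ker => /andP[_ /eqP->].
rewrite basisEdim flatten_cat flatten_seq1 span_cat size_cat sz_cs1.
apply/andP; split.
  apply/subvP => u uU; have : f u \in (f @: <<flatten cs1>>)%VS.
    by rewrite fcs1 memv_img.
  case/memv_imgP => w wcs1 fuw.
  have wU : w \in U.
    apply: (subvP _ _ wcs1); apply/span_subvP => v /flattenP[_ /mapP[c ccs' ->]].
    rewrite mem_rcons inE => /orP[/eqP->|vc]; first by case/and3P: (preP c ccs').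
    by apply: (subvP fU); apply: mem_cs vc.
  have : u - w \in Kf by rewrite memv_cap memv_ker memvB //= linearB /= fuw subrr.
  rewrite /Kf -spD => /memv_addP[a aK [b bD uw]].
  rewrite -(subrK w u) uw addrAC; apply: memv_add => //; rewrite memvD //.
  by apply: (subvP sub_cs); apply: (subvP (capvSl _ _) _ aK).
rewrite -(limg_ker_dim f U) -[\dim (U :&: lker f)]szD dKf'.
rewrite -(span_basis bcs) (eqP frcs).
by rewrite [leqRHS]addnC (addnC (size D)) addnA.
Qed.

End GradedJordanBasis.

(** * Nilpotent matrices and parity *)

Lemma row_expmx (k : fieldType) r (A : 'M[k]_r) (w : 'rV_r) a i :
  w *m A = a *: w -> w *m A ^+ i = a ^+ i *: w.
Proof.
move=> wA; elim: i => [|i IH]; first by rewrite !expr0 scale1r mulmx1.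
by rewrite exprSr -mulmxE mulmxA IH -scalemxAl wA scalerA -exprSr.
Qed.

Section NilpotentMatrices.
Variable k : closedFieldType.

Lemma exists_eigenvalue r (A : 'M[k]_r.+1) : exists a, eigenvalue A a.
Proof.
have /closed_rootP[a ra] : size (char_poly A) != 1 by rewrite size_char_poly.
by exists a; rewrite eigenvalue_root_char.
Qed.

Lemma ad_nilpotent_shift r (Y : 'M[k]_r.+1) N :
  (forall E : 'M_r.+1, iter N (fun E => Y *m E - E *m Y) E = 0) ->
  exists a, (Y - a%:M) ^+ N = 0.
Proof.
move=> adN; have [a /eigenvalueP[w wY w0]] := exists_eigenvalue Y.
exists a; have [j wj] : exists j, w 0 j != 0.
  apply/existsP; apply: contraNT w0; rewrite negb_exists => /forallP w0.
  by apply/eqP/rowP => j; rewrite mxE; apply/eqP; rewrite -[_ == _]negbK.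
(* On E = v w the operator ad Y acts as left multiplication by Y - a. *)
have adE (v : 'cV_r.+1) i : iter i (fun E => Y *m E - E *m Y) (v *m w) =
    (Y - a%:M) ^+ i *m v *m w.
  elim: i => [|i IH]; first by rewrite expr0 mul1mx.
  rewrite iterS IH exprS -mulmxE -(mulmxA (Y - a%:M)).
  set M := _ *m v; rewrite -(mulmxA M) wY -scalemxAr mulmxA.
  by rewrite mulmxBl mul_scalar_mx mulmxBl -scalemxAl.
apply/matrixP => i l; have /matrixP/(_ i j) := adN (delta_mx l 0 *m w).
rewrite adE -colE mxE big_ord1 !mxE => /eqP.
by rewrite mulf_eq0 (negPf wj) orbF => /eqP.
Qed.

Lemma nilpotent_shift_trace0 r (Y : 'M[k]_r.+1) a N :
  [pchar k] =i pred0 -> (Y - a%:M) ^+ N = 0 -> \tr Y = 0 -> a = 0.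
Proof.
move=> char0 YN trY.
have root_a b : root (char_poly Y) b -> b = a.
  rewrite -eigenvalue_root_char => /eigenvalueP[w wY w0].
  have /(row_expmx N) : w *m (Y - a%:M) = (b - a) *: w.
    by rewrite mulmxBr wY mul_mx_scalar scalerBl.
  rewrite YN mulmx0 => /esym/eqP; rewrite scaler_eq0 (negPf w0) orbF.
  by rewrite expf_eq0 subr_eq0 => /andP[_ /eqP].
have [rs] := closed_field_poly_normal (char_poly Y).
rewrite (monicP (char_poly_monic Y)) scale1r => rsE.
have szrs : size rs = r.+1.
  by have := size_char_poly Y; rewrite rsE size_prod_XsubC => -[].
have rsa : rs = nseq r.+1 a.
  rewrite -szrs; apply/all_pred1P/allP => b brs.
  by apply/eqP/root_a; rewrite rsE root_prod_XsubC.
have := @char_poly_trace _ _ Y isT.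
rewrite trY oppr0 rsE /= -[X in _`_X]/(r.+1.-1) -szrs coefPn_prod_XsubC ?szrs //.
rewrite rsa big_nseq iter_addr_0 => /eqP; rewrite oppr_eq0 -mulr_natr mulf_eq0.
by rewrite ((pcharf0P k).1 char0) orbF => /eqP.
Qed.

Lemma nilpotent_of_ad_nilpotent r (Y : 'M[k]_r) N :
  [pchar k] =i pred0 -> \tr Y = 0 ->
  (forall E : 'M_r, iter N (fun E => Y *m E - E *m Y) E = 0) -> Y ^+ N = 0.
Proof.
case: r Y => [|r] Y char0 trY adN; first by rewrite [LHS]flatmx0 [RHS]flatmx0.
have [a YN] := ad_nilpotent_shift adN.
by move: (YN); rewrite (nilpotent_shift_trace0 char0 YN trY) raddf0 subr0.
Qed.

End NilpotentMatrices.

Section Parity.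
Variables (k : fieldType) (m n : nat).
Implicit Types (A B h : 'M[k]_(m + n)) (v : 'cV[k]_(m + n)).

Definition even_proj : 'M[k]_(m + n) := block_mx 1%:M 0 0 0.

Lemma memMgr p A : (A \in Mgr k m n p) = (mpart (~~ p) A == 0).
Proof. by rewrite memv_ker lfunE. Qed.

Lemma memVgr p v : (v \in Vgr k m n p) = (vpart (~~ p) v == 0).
Proof. by rewrite memv_ker lfunE. Qed.

Lemma vpartE p v :
  vpart p v = if p then (1%:M - even_proj) *m v else even_proj *m v.
Proof.
have evE : even_proj *m v = col_mx (usubmx v) 0.
  by rewrite -{1}[v]vsubmxK mul_block_col mul1mx !mul0mx !addr0.
case: p => //=; rewrite mulmxBl mul1mx evE -{2}[v]vsubmxK opp_col_mx add_col_mx.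
by rewrite subrr subr0.
Qed.

Lemma vpartD v : vpart false v + vpart true v = v.
Proof. by rewrite /vpart add_col_mx addr0 add0r vsubmxK. Qed.

Lemma mpartD A : mpart false A + mpart true A = A.
Proof. by rewrite /mpart add_block_mx !addr0 !add0r submxK. Qed.

Lemma vpart_mem p v : vpart p v \in Vgr k m n p.
Proof.
by rewrite memVgr /vpart; case: p; rewrite /= ?col_mxKu ?col_mxKd col_mx0.
Qed.

Lemma vpart_id p v : v \in Vgr k m n p -> vpart p v = v.
Proof.
rewrite memVgr => /eqP v0; rewrite -[RHS]vpartD.
by case: p v0 => /= ->; rewrite ?addr0 ?add0r.
Qed.

Lemma mpart_id p A : A \in Mgr k m n p -> mpart p A = A.
Proof.
rewrite memMgr => /eqP A0; rewrite -[RHS]mpartD.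
by case: p A0 => /= ->; rewrite ?addr0 ?add0r.
Qed.

Lemma Vgr_direct : (Vgr k m n false :&: Vgr k m n true = 0)%VS.
Proof.
apply/eqP; rewrite -subv0; apply/subvP => v; rewrite memv_cap memv0.
by case/andP=> /vpart_id {2}<-; rewrite memVgr.
Qed.

Lemma even_block A : A \in Mgr k m n false -> A = block_mx (ulsubmx A) 0 0 (drsubmx A).
Proof. by move=> eA; exact: esym (mpart_id eA). Qed.

Lemma odd_block A : A \in Mgr k m n true -> A = block_mx 0 (ursubmx A) (dlsubmx A) 0.
Proof. by move=> eA; exact: esym (mpart_id eA). Qed.

Lemma evenP A : reflect (even_proj *m A = A *m even_proj) (A \in Mgr k m n false).
Proof.
apply: (iffP idP) => [/even_block ->|].
  by rewrite !mulmx_block !(mul1mx, mulmx1, mul0mx, mulmx0, addr0).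
rewrite -{1 2}[A]submxK !mulmx_block !(mul1mx, mulmx1, mul0mx, mulmx0, addr0).
by case/eq_block_mx => _ ur0 dl0 _; rewrite memMgr /= ur0 -dl0 block_mx0.
Qed.

Lemma even_mulmx A B : A \in Mgr k m n false -> B \in Mgr k m n false ->
  A *m B \in Mgr k m n false.
Proof. by move=> /evenP eA /evenP eB; apply/evenP; rewrite mulmxA eA -!mulmxA eB. Qed.

Lemma even_scalar a : a%:M \in Mgr k m n false.
Proof. by apply/evenP; rewrite scalar_mxC. Qed.

Lemma odd_mulmxV A p v : A \in Mgr k m n true -> v \in Vgr k m n p ->
  A *m v \in Vgr k m n (~~ p).
Proof.
move=> /odd_block -> /vpart_id <-; rewrite memVgr negbK /vpart.
by case: p; rewrite mul_block_col !(mul0mx, mulmx0, addr0, add0r) ?col_mxKu ?col_mxKd col_mx0.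
Qed.

Lemma scomm_even h A : h \in Mgr k m n false -> scomm h A = h *m A - A *m h.
Proof.
move=> h0; have /eqP h1 : mpart true h == 0 by rewrite -(memMgr false).
rewrite /scomm !big_bool (mpart_id h0) h1.
rewrite !(mul0mx, mulmx0, scaler0, subr0, add0r) expr0 !scale1r.
by rewrite -[A in RHS]mpartD mulmxDr mulmxDl opprD addrACA [RHS]addrC /= !oppr0 !add0r.
Qed.

Lemma scomm_odd A : A \in Mgr k m n true -> scomm A A = A *m A + A *m A.
Proof.
move=> A1; have /eqP A0 : mpart false A == 0 by rewrite -(memMgr true).
rewrite /scomm !big_bool (mpart_id A1) A0.
by rewrite /= !(mul0mx, mulmx0, scaler0, subr0, addr0) expr1 scaleN1r opprK.
Qed.

Lemma strace_mulC A B : A \in Mgr k m n false -> strace (A *m B) = strace (B *m A).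
Proof.
move=> /even_block ->; rewrite -[B]submxK !mulmx_block /strace.
rewrite !(block_mxKul, block_mxKdr) !(mul0mx, mulmx0, addr0, add0r).
by rewrite mxtrace_mulC [\tr (drsubmx A *m _)]mxtrace_mulC.
Qed.

Lemma strace_scalar a : strace (a%:M : 'M[k]_(m + n)) = a * (m%:R - n%:R).
Proof.
by rewrite scalar_mx_block /strace block_mxKul block_mxKdr !mxtrace_scalar mulrBr !mulr_natr.
Qed.

End Parity.

Section MatrixEndomorphisms.
Variables (k : fieldType) (r : nat).
Implicit Types (A B C M e h x : 'M[k]_r).

Definition mxlfun A : 'End('cV[k]_r) := linfun (mulmx A).

Lemma mxlfunE A v : mxlfun A v = A *m v.
Proof. by rewrite lfunE. Qed.

Lemma mxlfun_exp_img A N (U : {vspace 'cV[k]_r}) :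
  iter N (lfun_img (mxlfun A)) U = (mxlfun (A ^+ N) @: U)%VS.
Proof.
elim: N => [|N IH].
  rewrite -[LHS]lim1g expr0; apply: eq_in_limg => v _.
  by rewrite id_lfunE mxlfunE mul1mx.
rewrite iterS IH -limg_comp; apply: eq_in_limg => v _.
by rewrite comp_lfunE !mxlfunE exprS -mulmxE mulmxA.
Qed.

Lemma mxlfun_nilpotent_img A N (U : {vspace 'cV[k]_r}) : A ^+ N = 0 ->
  iter N (lfun_img (mxlfun A)) U = 0%VS.
Proof.
move=> AN; rewrite mxlfun_exp_img AN -[RHS](lim0g _ U).
by apply: eq_in_limg => v _; rewrite mxlfunE mul0mx zero_lfunE.
Qed.

Lemma eq_mulmx_cV A B : (forall v : 'cV_r, A *m v = B *m v) -> A = B.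
Proof.
move=> eqAB; apply/matrixP => i j.
by have /matrixP/(_ i 0) := eqAB (delta_mx j 0); rewrite -!colE !mxE.
Qed.

Lemma mxlfun_surj (phi : 'End('cV[k]_r)) : exists A, forall v, A *m v = phi v.
Proof.
exists (\matrix_(i, j) phi (delta_mx j 0) i 0) => v.
rewrite {2}(matrix_sum_delta v) linear_sum /=; apply/matrixP => i j.
rewrite !ord1 mxE summxE; apply: eq_bigr => l _.
by rewrite big_ord1 linearZ !mxE mulrC.
Qed.

Lemma mulmx_prime B C : (forall A, B *m A *m C = 0) -> B = 0 \/ C = 0.
Proof.
move=> BAC; have [->|/matrix0Pn[i [j Bij]]] := eqVneq B 0; first by left.
right; apply/matrixP => s t; rewrite mxE.
have /matrixP/(_ i t) := BAC (delta_mx j s).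
rewrite -(mul_delta_mx (0 : 'I_1)) mulmxA -colE -mulmxA -rowE !mxE big_ord1 !mxE.
by move=> /eqP; rewrite mulf_eq0 (negPf Bij) => /eqP.
Qed.

Lemma commutator_shift A B c :
  (A - c%:M) *m B - B *m (A - c%:M) = A *m B - B *m A.
Proof. by rewrite mulmxBl mulmxBr scalar_mxC opprB addrA subrK. Qed.

Lemma commutator_shiftr A B c :
  A *m (B - c%:M) - (B - c%:M) *m A = A *m B - B *m A.
Proof. by rewrite -opprB commutator_shift opprB. Qed.

Lemma ad_nilpotent_eigenvalue M e c N :
  M ^+ N = 0 -> M *m e - e *m M = c *: e -> e != 0 -> c = 0.
Proof.
move=> MN Me; apply: contra_neq_eq => c0.
have Mec : M *m e = e *m M + c *: e by rewrite -Me addrC subrK.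
suff eM i : e *m M ^+ i = 0 -> e = 0 by apply: (eM N); rewrite MN mulmx0.
elim: i => [|i IH]; first by rewrite expr0 mulmx1.
rewrite exprS -mulmxE mulmxA => eMi; apply: IH.
have : M *m (e *m M ^+ i) = c *: (e *m M ^+ i).
  by rewrite mulmxA Mec mulmxDl eMi add0r scalemxAl.
set f := e *m _ => Mf.
have MfN j : M ^+ j *m f = c ^+ j *: f.
  elim: j => [|j IHj]; first by rewrite !expr0 mul1mx scale1r.
  by rewrite exprSr -mulmxE -mulmxA Mf -scalemxAr IHj scalerA -exprS.
have /eqP := MfN N.
by rewrite MN mul0mx eq_sym scaler_eq0 expf_eq0 (negPf c0) andbF => /eqP.
Qed.

(* Modulo the line ker x, on which h acts by a, the operator h - a lowers the  *)
(* filtration by the kernels of the powers of x.                              *)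
Lemma centralizer_dim_ker1 x h N : \dim (lker (mxlfun x)) = 1%N -> x ^+ N = 0 ->
  h *m x = x *m h -> exists a, (h - a%:M) ^+ N = 0.
Proof.
move=> dker xN hx; set K := lker _ in dker.
have K0 : vpick K != 0 by rewrite vpick0 -dimv_eq0 dker.
have KE : K = <[vpick K]>%VS.
  by apply/eqP; rewrite eq_sym eqEdim -memvE memv_pick dker dim_vline K0.
have memK v : (v \in K) = (x *m v == 0) by rewrite memv_ker mxlfunE.
have xu : x *m vpick K = 0 by apply/eqP; rewrite -memK memv_pick.
have /vlineP[a hu] : h *m vpick K \in <[vpick K]>%VS.
  by rewrite -KE memK mulmxA -hx -mulmxA xu mulmx0.
exists a; set M := h - _; have Mx : M *m x = x *m M.
  by rewrite mulmxBl mulmxBr hx scalar_mxC.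
have MK v : v \in K -> M *m v = 0.
  rewrite KE => /vlineP[b ->].
  by rewrite -scalemxAr mulmxBl hu mul_scalar_mx subrr scaler0.
have MxX i : M *m x ^+ i = x ^+ i *m M.
  elim: i => [|i IH]; first by rewrite expr0 mulmx1 mul1mx.
  by rewrite exprS -mulmxE mulmxA Mx -mulmxA IH mulmxA.
have lower i (v : 'cV_r) : x ^+ i *m v = 0 -> M ^+ i *m v = 0.
  elim: i v => [|i IH] v; first by rewrite !expr0.
  rewrite exprS -mulmxE -mulmxA => /eqP; rewrite -memK => /MK.
  by rewrite mulmxA MxX -mulmxA => /IH; rewrite exprSr -mulmxE mulmxA.
by apply: eq_mulmx_cV => v; rewrite mul0mx lower // xN mul0mx.
Qed.

Lemma nilpotent_diag_eq0 M N : M ^+ N = 0 ->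
  (forall i, M *m delta_mx i i = delta_mx i i *m M) -> M = 0.
Proof.
move=> MN Mdiag.
have Moff i j : i != j -> M i j = 0.
  move=> ij; have /matrixP/(_ i j) := Mdiag j.
  rewrite -(mul_delta_mx (0 : 'I_1)) mulmxA -[in RHS]mulmxA -colE -rowE !mxE !big_ord1 !mxE.
  by rewrite eqxx eqxx mulr1 (negPf ij) mul0r.
apply/matrixP => i j; rewrite [RHS]mxE.
have [->|/Moff//] := eqVneq i j.
have wM : delta_mx (0 : 'I_1) j *m M = M j j *: delta_mx 0 j.
  rewrite -rowE; apply/rowP => l; rewrite !mxE eqxx.
  by have [->|/Moff->] := eqVneq j l; rewrite ?mulr1 ?mulr0.
have /matrixP/(_ 0 j) := row_expmx N wM.
by rewrite MN mulmx0 !mxE !eqxx mulr1 => /esym/eqP; rewrite expf_eq0 => /andP[_ /eqP].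
Qed.

End MatrixEndomorphisms.

(** * Graded modules over k[x] *)

Section Modules.
Variables (k : fieldType) (m n : nat) (x : 'M[k]_(m + n)).
Local Notation V := 'cV[k]_(m + n).
Implicit Types (U W : {vspace V}).

Lemma fullv_neq0 : (0 < m + n)%N -> (fullv : {vspace V}) <> 0%VS.
Proof.
by move=> mn /eqP; rewrite -dimv_eq0 dimvf dim_matrix mulr1 eqn0Ngt mn.
Qed.

Lemma nilpotent_submodule_ker N U : x ^+ N = 0 ->
  (forall v, v \in U -> x *m v \in U) -> (U :&: lker (mxlfun x))%VS = 0%VS -> U = 0%VS.
Proof.
move=> xN stU kerU; have sU : (mxlfun x @: U <= U)%VS.
  by apply/subvP => _ /memv_imgP[v vU ->]; rewrite mxlfunE stU.
have imU : (mxlfun x @: U)%VS = U.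
  by apply/eqP; rewrite eqEdim sU (limg_dim_eq kerU) /=.
have : iter N (lfun_img (mxlfun x)) U = U by elim: N {xN} => //= N ->.
by rewrite mxlfun_nilpotent_img.
Qed.

Lemma indecomposable_dim_ker1 N : (0 < m + n)%N -> x ^+ N = 0 ->
  \dim (lker (mxlfun x)) = 1%N -> indecomposable_module x.
Proof.
move=> mn xN dker; split.
  exact: fullv_neq0.
move=> U W [_ stU] [_ stW] _ UW0.
have [->|U0] := eqVneq U 0%VS; first by left.
have [->|W0] := eqVneq W 0%VS; first by right.
have kerN0 (Z : {vspace V}) : (forall v, v \in Z -> x *m v \in Z) -> Z != 0%VS ->
    (0 < \dim (Z :&: lker (mxlfun x)))%N.
  move=> stZ; rewrite lt0n dimv_eq0; apply: contra_neq.
  exact: nilpotent_submodule_ker xN stZ.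
have disj : (U :&: lker (mxlfun x) :&: (W :&: lker (mxlfun x)) = 0)%VS.
  by apply/eqP; rewrite -subv0 -UW0 capvS ?capvSl.
have : (\dim (U :&: lker (mxlfun x)) + \dim (W :&: lker (mxlfun x)) <= 1)%N.
  by rewrite -dimv_disjoint_sum // -[leqRHS]dker dimvS // subv_add !capvSr.
have := kerN0 _ stU U0; have := kerN0 _ stW W0.
by case: (\dim _) => // a; case: (\dim _) => // b; rewrite addnS.
Qed.

Lemma jordan_chainP c : jordan_chain x c <->
  [&& c != [::], all (homogeneous (Vgr k m n)) c & chain (mxlfun x) c].
Proof.
split=> [[nec homc chc]|/and3P[nec /allP homc /chainP chc]].
  rewrite nec /=; apply/andP; split; last by apply/chainP => i /chc; rewrite mxlfunE.
  by apply/allP => v /homc[p vp]; apply/orP; case: p vp; [right | left].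
split=> // [v /homc/orP[]|i /chc]; first by exists false.
  by exists true.
by rewrite mxlfunE.
Qed.

Lemma exists_homog_jordan_basis N : x \in Mgr k m n true -> x ^+ N = 0 ->
  exists cs, homog_jordan_basis x cs.
Proof.
move=> x1 xN.
have odd p v : v \in Vgr k m n p -> mxlfun x v \in Vgr k m n (~~ p).
  by rewrite mxlfunE; apply: odd_mulmxV.
have grf : graded (Vgr k m n) fullv.
  apply/eqP/gradedP => v _; exists (fun p => vpart p v); split=> [|p].
    by rewrite vpartD.
  by rewrite memv_cap memvf vpart_mem.
have [|cs bcs ccs] :=
    homogeneous_jordan_basis (@Vgr_direct k m n) odd grf (subvf _) (N := N).
  exact: mxlfun_nilpotent_img.
by exists cs; split=> // c /(allP ccs) ?; apply/jordan_chainP.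
Qed.

Lemma jordan_basis_dim_ker cs : homog_jordan_basis x cs ->
  \dim (lker (mxlfun x)) = size cs.
Proof.
case=> chcs bcs; rewrite -(capfv (lker _)) -(span_basis bcs).
rewrite dim_ker_chains ?(basis_free bcs) //; apply/allP => c /chcs/jordan_chainP.
  by case/and3P.
by case/and3P.
Qed.

Definition graded_decomposition U W :=
  [/\ graded_submodule x U, graded_submodule x W, (U + W)%VS = fullv &
      (U :&: W)%VS = 0%VS].

Lemma graded_submodule_chains cs : (forall c, c \in cs -> jordan_chain x c) ->
  graded_submodule x <<flatten cs>>.
Proof.
move=> chcs; split.
  apply: graded_span; apply/allP => v /flattenP[c /chcs/jordan_chainP].
  by case/and3P=> _ /allP homc _ /homc.
have /subvP stcs : (mxlfun x @: <<flatten cs>> <= <<flatten cs>>)%VS.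
  by apply: span_chains_stable; apply/allP => c /chcs/jordan_chainP/and3P[].
by move=> v vcs; apply: stcs; rewrite -mxlfunE memv_img.
Qed.

Lemma jordan_basis_decomposition cs : (0 < m + n)%N -> homog_jordan_basis x cs ->
  size cs <> 1%N ->
  exists U W, [/\ graded_decomposition U W, U <> 0%VS & W <> 0%VS].
Proof.
move=> mn; case: cs => [|c1 [|c2 cs]] // [chcs bcs] _.
  by have := span_basis bcs; rewrite span_nil => /esym/(fullv_neq0 mn).
exists <<flatten [:: c1]>>%VS, <<flatten (c2 :: cs)>>%VS.
have fr := basis_free bcs; rewrite -cat1s flatten_cat in bcs fr.
have span0 c X : c != [::] -> free (c ++ X) -> <<c ++ X>>%VS <> 0%VS.
  by case: c => // v c _ /eqP fr' /eqP; rewrite -dimv_eq0 fr'.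
have ne c : c \in [:: c1, c2 & cs] -> c != [::] by case/chcs.
split; first split.
- by apply: graded_submodule_chains => c; rewrite inE => /eqP->; apply: chcs; rewrite inE eqxx.
- by apply: graded_submodule_chains => c c2cs; apply: chcs; rewrite inE c2cs orbT.
- by rewrite -span_cat (span_basis bcs).
- by move: fr; rewrite cat_free => /and3P[_ _ /directv_addP].
- by apply: span0; [apply: ne; rewrite inE eqxx | exact: catl_free fr].
- by apply: span0; [apply: ne; rewrite !inE eqxx orbT | exact: catr_free fr].
Qed.

Lemma graded_projection U W : x \in Mgr k m n true ->
  graded_decomposition U W -> U <> 0%VS -> W <> 0%VS ->
  exists h, [/\ h \in Mgr k m n false, h *m x = x *m h, h *m h = h, h <> 0 & h <> 1%:M].
Proof.
move=> x1 [[grU stU] [grW stW] UWf UW0] U0 W0.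
have [h hE] := mxlfun_surj (daddv_pi U W).
have hU u : u \in U -> h *m u = u by move=> uU; rewrite hE daddv_pi_id.
have hW w : w \in W -> h *m w = 0.
  move=> wW; have := @daddv_pi_add _ _ U W w UW0; rewrite UWf memvf => /(_ isT).
  rewrite [in X in _ + X]daddv_pi_id ?(capvC W) // hE => /(canRL (addrK w)).
  by rewrite subrr.
have decomp (P : V -> Prop) : (forall u w, u \in U -> w \in W -> P (u + w)) -> forall v, P v.
  move=> PUW v; have : v \in (U + W)%VS by rewrite UWf memvf.
  by case/memv_addP => u uU [w wW ->]; apply: PUW.
have grE (Z : {vspace V}) v :
    Z = (Z :&: Vgr k m n false + Z :&: Vgr k m n true)%VS -> v \in Z ->
    even_proj k m n *m v \in Z.
  move=> grZ; rewrite grZ => /memv_addP[v0 + [v1 + ->]].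
  rewrite !memv_cap -grZ => /andP[v0Z v00] /andP[_ v11].
  have v1E : vpart false v1 = 0 by apply/eqP; rewrite -(memVgr true).
  suff -> : even_proj k m n *m (v0 + v1) = v0 by [].
  by rewrite mulmxDr -!(vpartE false) v1E addr0 vpart_id.
exists h; split.
- apply/evenP/eq_mulmx_cV; apply: decomp => u w uU wW.
  rewrite -!mulmxA !mulmxDr (hU u) // (hW w) // mulmx0 addr0.
  by rewrite (hU (even_proj k m n *m u)) ?(hW (even_proj k m n *m w)) ?grE // addr0.
- apply/eq_mulmx_cV; apply: decomp => u w uU wW.
  rewrite -!mulmxA !mulmxDr (hU u) // (hW w) // mulmx0 addr0.
  by rewrite (hU (x *m u)) ?(hW (x *m w)) ?stU ?stW // addr0.
- apply/eq_mulmx_cV; apply: decomp => u w uU wW.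
  by rewrite -!mulmxA !mulmxDr (hU u) // (hW w) // mulmx0 !addr0 (hU u).
- move=> h0; apply: U0; apply/eqP; rewrite -subv0; apply/subvP => u /hU.
  by rewrite h0 mul0mx => <-; rewrite mem0v.
- move=> h1; apply: W0; apply/eqP; rewrite -subv0; apply/subvP => w /hW.
  by rewrite h1 mul1mx => ->; rewrite mem0v.
Qed.

End Modules.

(** * Distinguished elements *)

Section Distinguished.
Variables (k : fieldType) (m n : nat) (g : {vspace 'M[k]_(m + n)}).
Implicit Types (A B h x e : 'M[k]_(m + n)).
(* These two properties are all that is used of gl(m|n) and of sl(m|n) with    *)
(* m <> n.                                                                    *)
Hypothesis g_scalar : forall A, exists c, A - c%:M \in g.
Hypothesis g_comm : forall h A, h \in Mgr k m n false -> h *m A - A *m h \in g.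

Definition ad_end h : 'End('M[k]_(m + n)) := linfun (mulmx h) - linfun (mulmxr h).

Lemma ad_endE h A : ad_end h A = h *m A - A *m h.
Proof. by rewrite add_lfunE opp_lfunE !lfunE. Qed.

Lemma even_delta_diag i : delta_mx i i \in Mgr k m n false.
Proof.
rewrite memMgr /=; apply/eqP; rewrite -[RHS]block_mx0.
by congr block_mx; apply/matrixP => a b; rewrite !mxE;
  case: (split_ordP i) => j ->; rewrite ?eq_lrshift ?eq_rlshift ?andbF.
Qed.

Lemma scalar_in_center_even a : a%:M \in g -> in_center_even g a%:M.
Proof.
move=> ag; split; last exact: even_scalar; split=> // A _.
by rewrite scomm_even ?even_scalar // scalar_mxC subrr.
Qed.

Lemma distinguished_dim_ker1 x N : x ^+ N = 0 ->
  \dim (lker (mxlfun x)) = 1%N -> distinguished g x.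
Proof.
move=> xN dker h [h0 [b [bas eig]]].
have [hg he] : h \in g /\ h \in Mgr k m n false by apply/andP; rewrite -memv_cap.
rewrite scomm_even // => /eqP; rewrite subr_eq0 => /eqP hx.
have [a MN] := centralizer_dim_ker1 dker xN hx.
have bker e : e \in b -> e \in lker (ad_end h).
  move=> eb; have [c] := eig e eb; rewrite memv_ker ad_endE scomm_even // => hec.
  have : (h - a%:M) *m e - e *m (h - a%:M) = c *: e by rewrite commutator_shift.
  move/(ad_nilpotent_eigenvalue MN) => c0.
  by rewrite hec c0 ?scale0r // (basis_not0 bas).
have h_ker A : A \in Mgr k m n false -> h *m A = A *m h.
  move=> A0; have [c Ac] := g_scalar A.
  have : A - c%:M \in homog_part g false.
    by rewrite memv_cap Ac memvB ?even_scalar.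
  rewrite -(span_basis bas) => /(subvP (introT span_subvP bker)).
  by rewrite memv_ker ad_endE commutator_shiftr => /eqP/subr0_eq.
have : h - a%:M = 0.
  apply: (nilpotent_diag_eq0 MN) => i; apply/subr0_eq.
  by rewrite commutator_shift h_ker ?subrr ?even_delta_diag.
by move/subr0_eq => ha; rewrite ha in hg *; apply: scalar_in_center_even.
Qed.

Lemma semisimple_even_idempotent h c : h \in Mgr k m n false -> h *m h = h ->
  h - c%:M \in g -> semisimple_even g (h - c%:M).
Proof.
move=> he hh hg; pose g0 := homog_part g false.
have hce : h - c%:M \in Mgr k m n false by rewrite memvB ?even_scalar.
split; first by rewrite memv_cap hg.
pose E a := (g0 :&: lker (ad_end h - a *: \1%VF))%VS.
have memE a e : (e \in E a) = (e \in g0) && (h *m e - e *m h == a *: e).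
  by rewrite memv_cap memv_ker add_lfunE opp_lfunE scale_lfunE id_lfunE ad_endE subr_eq0.
pose X := vbasis (E 0) ++ vbasis (E 1) ++ vbasis (E (- 1)).
have eigX e : e \in X -> exists a, e \in E a.
  by rewrite !mem_cat => /or3P[] /vbasis_mem; [exists 0 | exists 1 | exists (- 1)].
have spX : <<X>>%VS = g0.
  apply/eqP; rewrite eqEsubv; apply/andP; split.
    by apply/span_subvP => e /eigX[a]; rewrite memE => /andP[].
  apply/subvP => e; rewrite memv_cap => /andP[eg ee].
  pose f := h *m e *m h.
  have hf : h *m f = f by rewrite /f !mulmxA hh.
  have fh : f *m h = f by rewrite /f -!mulmxA hh.
  pose e1 := h *m e - f; pose e2 := e *m h - f.
  have ad1 : h *m e1 - e1 *m h = e1.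
    by rewrite mulmxBr mulmxBl mulmxA hh hf fh subrr subr0.
  have ad2 : h *m e2 - e2 *m h = - e2.
    by rewrite mulmxBr mulmxBl hf fh mulmxA subrr sub0r -mulmxA hh.
  have fe : f \in Mgr k m n false by rewrite !even_mulmx.
  have e1g : e1 \in g0.
    by rewrite memv_cap -{1}ad1 g_comm //= memvB // even_mulmx.
  have e2g : e2 \in g0.
    by rewrite memv_cap -memvN -ad2 g_comm //= memvB // even_mulmx.
  have ev1 : e1 \in E 1 by rewrite memE e1g ad1 scale1r eqxx.
  have ev2 : e2 \in E (- 1) by rewrite memE e2g ad2 scaleN1r eqxx.
  have ev0 : e - (e1 + e2) \in E 0.
    rewrite memE; apply/andP; split.
      by apply: memvB; [rewrite memv_cap eg | exact: memvD].
    rewrite -ad_endE linearB linearD /= !ad_endE ad1 ad2 scale0r.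
    suff -> : e1 - e2 = h *m e - e *m h by rewrite subrr.
    by rewrite /e1 /e2 opprB addrA subrK.
  rewrite -(subrK (e1 + e2) e) !span_cat !(span_basis (vbasisP _)).
  by do !apply: memv_add.
have [b bas bX] := span_subbasis X; rewrite spX in bas.
exists b; split=> // e /bX/eigX[a]; rewrite memE => /andP[_ /eqP hea].
by exists a; rewrite scomm_even // commutator_shift.
Qed.

Lemma idempotent_not_distinguished x h : h \in Mgr k m n false ->
  h *m x = x *m h -> h *m h = h -> h <> 0 -> h <> 1%:M -> ~ distinguished g x.
Proof.
move=> he hx hh h0 h1 dist; have [c hg] := g_scalar h.
have hce : h - c%:M \in Mgr k m n false by rewrite memvB ?even_scalar.
have [|[_ cent] _] := dist _ (semisimple_even_idempotent he hh hg).
  by rewrite scomm_even // commutator_shift hx subrr.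
have hC A : h *m A = A *m h.
  have [d Ad] := g_scalar A; apply/subr0_eq.
  by have := cent _ Ad; rewrite scomm_even // commutator_shift commutator_shiftr.
have [|//|/subr0_eq/esym//] := @mulmx_prime _ _ h (1%:M - h).
by move=> A; rewrite hC -mulmxA mulmxBr mulmx1 hh subrr mulmx0.
Qed.

End Distinguished.

Section EvenTrace.
Variables (k : fieldType) (m n : nat).

Definition even_trace (A : 'M[k]_(m + n)) : k^o := \tr (ulsubmx A).

Fact even_trace_is_linear : linear even_trace.
Proof.
move=> a A B; rewrite -[RHS]linearP; congr (\tr _).
by apply/matrixP => i j; rewrite !mxE.
Qed.
HB.instance Definition _ :=
  GRing.isLinear.Build k _ _ _ even_trace even_trace_is_linear.

End EvenTrace.

Section AdNilpotent.
Variables (k : closedFieldType) (m n : nat) (g : {vspace 'M[k]_(m + n)}).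
Hypothesis char0 : [pchar k] =i pred0.
Hypothesis g_scalar : forall A : 'M[k]_(m + n), exists c, A - c%:M \in g.

Lemma derived_even_trace (A : 'M[k]_(m + n)) :
  A \in derived_even g -> \tr (ulsubmx A) = 0.
Proof.
suff /subvP sub : (derived_even g <= lker (linfun (@even_trace k m n)))%VS.
  by move/sub; rewrite memv_ker lfunE => /eqP.
apply/span_subvP => _ /allpairsP[[B C] [/vbasis_mem B0 /vbasis_mem C0 ->]].
move: B0 C0 => /=; rewrite !memv_cap => /andP[_ Be] /andP[_ Ce].
rewrite memv_ker lfunE /= scomm_even // (even_block Be) (even_block Ce).
rewrite !mulmx_block !(mul0mx, mulmx0, addr0, add0r) opp_block_mx add_block_mx.
by rewrite /even_trace block_mxKul raddfB /= mxtrace_mulC subrr.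
Qed.

Lemma ad_nilpotent_nilpotent x : x \in Mgr k m n true -> ad_nilpotent g x ->
  exists N, x ^+ N = 0.
Proof.
move=> x1 []; set s := scomm x x => s_der [N adN].
have sE : s = x ^+ 2 *+ 2 by rewrite /s scomm_odd // expr2 -mulmxE.
have x2e : x *m x \in Mgr k m n false.
  rewrite (odd_block x1) memMgr /= mulmx_block.
  by rewrite !(mul0mx, mulmx0, addr0, add0r) block_mxKur block_mxKdl block_mx0.
have se : s \in Mgr k m n false by rewrite /s scomm_odd // memvD.
pose S := ulsubmx s.
have SN : S ^+ N.+1 = 0.
  apply: nilpotent_of_ad_nilpotent => // [|E]; first exact: derived_even_trace.
  pose bl (F : 'M_m) := block_mx F 0 0 0 : 'M[k]_(m + n).
  have ble F : bl F \in Mgr k m n false.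
    by rewrite memMgr /= block_mxKur block_mxKdl block_mx0.
  have scomm_bl F : scomm s (bl F) = bl (S *m F - F *m S).
    rewrite scomm_even // (even_block se) !mulmx_block.
    rewrite !(mul0mx, mulmx0, addr0, add0r) opp_block_mx add_block_mx.
    by rewrite !oppr0 !addr0.
  have [c Ec] := g_scalar (bl E).
  have Ec0 : bl E - c%:M \in homog_part g false.
    by rewrite memv_cap Ec memvB ?even_scalar.
  have iter_bl i F : iter i (scomm s) (bl F) = bl (iter i (fun G => S *m G - G *m S) F).
    by elim: i => //= i ->.
  have : iter N.+1 (scomm s) (bl E) = 0.
    rewrite iterSr; have -> : scomm s (bl E) = scomm s (bl E - c%:M).
      by rewrite !scomm_even // commutator_shiftr.
    by rewrite -iterSr iterS adN // scomm_even // mulmx0 mul0mx subrr.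
  by rewrite iter_bl -[RHS](@block_mx0 k m n m n) => /eq_block_mx[].
have sX i : s ^+ i = block_mx (S ^+ i) 0 0 (drsubmx s ^+ i).
  elim: i => [|i IH]; first by rewrite !expr0 -scalar_mx_block.
  rewrite !exprS -!mulmxE IH {1}(even_block se) mulmx_block.
  by rewrite !(mul0mx, mulmx0, addr0, add0r).
pose P := even_proj k m n; pose M := N.+1.*2.
have xMP : x ^+ M *m P = 0.
  have : s ^+ N.+1 *m P = 0.
    rewrite sX SN mulmx_block.
    by rewrite !(mul0mx, mulmx0, addr0, add0r) block_mx0.
  rewrite sE exprMn_n -exprM mul2n -scaler_nat -scalemxAl => /eqP.
  by rewrite scaler_eq0 ((pcharf0P k).1 char0) expn_eq0 => /eqP.
have Px : P *m x = x *m (1%:M - P).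
  rewrite mulmxBr mulmx1 (odd_block x1) /P /even_proj !mulmx_block.
  rewrite !(mul0mx, mulmx0, mul1mx, mulmx1, addr0, add0r) opp_block_mx add_block_mx.
  by rewrite !oppr0 !addr0 subrr.
(* Since x maps the odd part into the even part, killing the even part is enough. *)
exists M.+1.
have xMQ : x ^+ M.+1 *m (1%:M - P) = 0.
  by rewrite exprSr -mulmxE -mulmxA -Px mulmxA xMP mul0mx.
rewrite -[LHS]mulmx1 -(subrK P 1%:M) mulmxDr xMQ add0r.
by rewrite exprS -mulmxE -mulmxA xMP mulmx0.
Qed.

End AdNilpotent.

Section GlSl.
Variables (k : fieldType) (m n : nat) (g : {vspace 'M[k]_(m + n)}).
Hypothesis char0 : [pchar k] =i pred0.
Hypothesis hg : g = gl_super k m n \/ (g = sl_super k m n /\ m <> n).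

Lemma natr_sub_neq0 : m <> n -> m%:R - n%:R != 0 :> k.
Proof.
move=> /eqP; rewrite neq_ltn => /orP[lt|lt].
  by rewrite -opprB oppr_eq0 -natrB ?(ltnW lt) // ((pcharf0P k).1 char0) -lt0n subn_gt0.
by rewrite -natrB ?(ltnW lt) // ((pcharf0P k).1 char0) -lt0n subn_gt0.
Qed.

Lemma gl_sl_scalar (A : 'M[k]_(m + n)) : exists c, A - c%:M \in g.
Proof.
case: hg => [->|[-> /natr_sub_neq0 mn0]]; first by exists 0; rewrite memvf.
exists (strace A / (m%:R - n%:R)); rewrite memv_ker lfunE /= linearB /=.
by rewrite strace_scalar divfK // subrr.
Qed.

Lemma gl_sl_comm (h A : 'M[k]_(m + n)) :
  h \in Mgr k m n false -> h *m A - A *m h \in g.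
Proof.
move=> he; case: hg => [->|[-> _]]; first by rewrite memvf.
by rewrite memv_ker lfunE /= linearB /= strace_mulC // subrr.
Qed.

End GlSl.

Theorem lemma7p3p2 (k : closedFieldType) (char0 : [pchar k] =i pred0)
    (m n : nat) (mn_gt0 : (0 < m + n)%N)
    (g : {vspace 'M[k]_(m + n)})
    (hg : g = gl_super k m n \/ (g = sl_super k m n /\ m <> n))
    (x : 'M[k]_(m + n)) (x_odd : x \in homog_part g true)
    (x_nil : ad_nilpotent g x) :
  [/\ distinguished g x <-> indecomposable_module x,
      exists D, checkered_diagram x D
    & forall D, checkered_diagram x D -> (distinguished g x <-> size D = 1%N)].
Proof.
have g_scalar := gl_sl_scalar char0 hg; have g_comm := gl_sl_comm hg.
have [_ x1] : x \in g /\ x \in Mgr k m n true by apply/andP; rewrite -memv_cap.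
have [N xN] := ad_nilpotent_nilpotent char0 g_scalar x1 x_nil.
have dist_size cs : homog_jordan_basis x cs -> distinguished g x <-> size cs = 1%N.
  move=> jb; split=> [dist|]; last first.
    by rewrite -(jordan_basis_dim_ker jb); apply: distinguished_dim_ker1 xN.
  apply/eqP/negPn/negP => /eqP/(jordan_basis_decomposition mn_gt0 jb).
  case=> U [W [UW U0 W0]]; have [h [he hx hh h0 h1]] := graded_projection x1 UW U0 W0.
  exact: idempotent_not_distinguished he hx hh h0 h1 dist.
have indec_size cs : homog_jordan_basis x cs ->
    indecomposable_module x <-> size cs = 1%N.
  move=> jb; split=> [[_ indec]|]; last first.
    by rewrite -(jordan_basis_dim_ker jb); apply: indecomposable_dim_ker1 xN.
  apply/eqP/negPn/negP => /eqP/(jordan_basis_decomposition mn_gt0 jb).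
  by case=> U [W [[grU grW UWf UW0] U0 W0]]; case: (indec U W).
have [cs jb] := exists_homog_jordan_basis x1 xN.
split.
- by apply: iff_trans (dist_size _ jb) _; apply: iff_sym; apply: indec_size.
- by exists [seq [seq v \in Vgr k m n false | v <- c] | c <- cs], cs.
- move=> D [cs' jb' /perm_size]; rewrite size_map => ->; exact: dist_size.
Qed.
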